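(* Fix an integer $K\geq 2$ and $r_1\in(0,1)$. Let $\mathcal{R}_K(r_1)$ be the set of all elements of $\mathcal{R}_K$ whose first coordinate is equal to $r_1$. Then, for $K=2$, $$ p(\mathcal{R}_K(r_1))=\bigg\{\frac{2r_1}{2r_1+1}\bigg\}, $$ whereas, for $K>2$, $$ p(\mathcal{R}_K(r_1))=\bigg(\frac{2r_1}{2r_1+1},\ \frac{2(K-2+r_1)}{4(K-2+r_1)+1-Kr_1}\bigg]. $$ For $K>2$, the lower bound $\frac{2r_1}{2r_1+1}$ is obtained as the limit of $p(r)$ as $r\to(r_1,1-r_1,0,\ldots,0)$ with $r\in\mathcal{R}_K(r_1)$, whereas the upper bound is achieved at $r=\big(r_1,\frac{1-r_1}{K-1},\ldots,\frac{1-r_1}{K-1}\big)$.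
   Context: For an integer $K\ge 2$, let $$\mathcal{R}_K=\Big\{r=(r_1,r_2,\ldots,r_K)\in(0,1)^K:\ \sum_{k=1}^K r_k=1,\ r_2\geq r_3\geq\cdots\geq r_K\Big\}$$ (no order constraint is imposed on $r_1$), and define $p:\mathcal{R}_K\to\mathbb{R}$ by $$p(r)=\frac{2}{3+\sum_{k=2}^K\frac{r_k}{1-r_k}}.$$ For $c\in(0,1)$, $\mathcal{R}_K(c):=\{r\in\mathcal{R}_K: r_1=c\}$, and $p(A)=\{p(r):r\in A\}$ denotes the image of $A\subseteq\mathcal{R}_K$. (Interpretation: $p(r)$ is the probability that a two-children family has a boy given that it has a girl named $n_1$, in a model where $K$ girl names $n_1,\ldots,n_K$ have popularities $r_1,\ldots,r_K$ and two sisters may not share a name, a second girl being named according to the rescaled popularities of the remaining names.) *)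

(* Defs.v *)
From mathcomp Require Import all_boot all_order all_algebra.
From mathcomp Require Import all_classical all_reals all_analysis.

Set Implicit Arguments.
Unset Strict Implicit.
Unset Printing Implicit Defensive.

Import Order.TTheory GRing.Theory Num.Theory.
Import numFieldNormedType.Exports.

Local Open Scope classical_set_scope.
Local Open Scope ring_scope.

(* Popularity vectors (r_1, ..., r_K) are row vectors r : 'rV[R]_K with the
   indices shifted by one: r_k is the entry of index k - 1, so r_1 is the entry
   whose index has value 0 and the entries of positive index are r_2, ..., r_K. *)

Definition popularities (R : realType) (K : nat) : set 'rV[R]_K :=
  [set r | [/\ forall i : 'I_K, 0 < r ord0 i < 1,
               \sum_(i < K) r ord0 i = 1
             & forall i j : 'I_K,
                 (0 < i)%N -> (i <= j)%N -> r ord0 j <= r ord0 i]].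

(* Quantifying over the indices of value 0 (there is exactly one when 0 < K)
   avoids carrying a proof of 0 < K. *)
Definition popularities_at (R : realType) (K : nat) (c : R) : set 'rV[R]_K :=
  [set r | popularities r /\ forall i : 'I_K, i = 0%N :> nat -> r ord0 i = c].

Definition prob_boy (R : realType) (K : nat) (r : 'rV[R]_K) : R :=
  2 / (3 + \sum_(i < K | (0 < i)%N) r ord0 i / (1 - r ord0 i)).

(* (c, 1 - c, 0, ..., 0) *)
Definition two_name_vector (R : realType) (K : nat) (c : R) : 'rV[R]_K :=
  \row_(i < K) (if i == 0%N :> nat then c
                else if i == 1%N :> nat then 1 - c else 0).

(* (c, (1 - c) / (K - 1), ..., (1 - c) / (K - 1)) *)
Definition uniform_vector (R : realType) (K : nat) (c : R) : 'rV[R]_K :=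
  \row_(i < K) (if i == 0%N :> nat then c else (1 - c) / (K%:R - 1)).

(* Main.v *)
(* Write f x = x / (1 - x). Every r_k with k >= 2 is smaller than 1 - r_1 as soon
   as there are two of them, so f r_k < r_k / r_1, and summing gives the strict
   lower bound on p. Convexity of f (its tangent at the mean of r_2, ..., r_K)
   bounds the sum of the f r_k below by its value at the uniform vector, which
   gives the upper bound on p. Every value in between is attained on the segment
   from (r_1, 1 - r_1, 0, ..., 0) to the uniform vector, by the intermediate
   value theorem. *)
Require Import Defs.
From mathcomp Require Import all_boot all_order all_algebra.
From mathcomp Require Import all_classical all_reals all_analysis.
From mathcomp Require Import ring lra zify.

Import Order.TTheory GRing.Theory Num.Theory.
Import numFieldNormedType.Exports.

Local Open Scope classical_set_scope.
Local Open Scope ring_scope.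

(** Convexity of [x / (1 - x)], whose derivative at [y] is [1 / (1 - y) ^+ 2]; the gap to the
    tangent is a square over a positive quantity. *)
Lemma odds_tangent (R : realFieldType) (x y : R) :
  x < 1 -> y < 1 -> y / (1 - y) + (x - y) / (1 - y) ^+ 2 <= x / (1 - x).
Proof.
move=> x1 y1; rewrite -subr_ge0.
have -> : x / (1 - x) - (y / (1 - y) + (x - y) / (1 - y) ^+ 2) =
    (x - y) ^+ 2 / ((1 - x) * (1 - y) ^+ 2).
  by field; apply/andP; split; rewrite subr_eq0 gt_eqF.
by rewrite divr_ge0 ?sqr_ge0// mulr_ge0 ?sqr_ge0// subr_ge0 ltW.
Qed.

Lemma prob_boyE (R : realType) (n : nat) (r : 'rV[R]_n.+1) : prob_boy r =
  2 / (3 + \sum_(i < n) r ord0 (lift ord0 i) / (1 - r ord0 (lift ord0 i))).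
Proof. by rewrite /prob_boy [in LHS]big_mkcond big_ord_recl /= add0r. Qed.

Lemma popularities_at_sum (R : realType) (n : nat) (c : R) (r : 'rV[R]_n.+1) :
  popularities_at c r -> \sum_(i < n) r ord0 (lift ord0 i) = 1 - c.
Proof.
move=> [[_ s1 _] r0]; move: s1; rewrite big_ord_recl r0// => <-.
by rewrite addrC addKr.
Qed.

Lemma sum_odds_ge (R : realType) (n : nat) (c : R) (r : 'rV[R]_n.+2) :
  0 < c -> popularities_at c r ->
  n.+1%:R * (1 - c) / (n%:R + c) <=
  \sum_(i < n.+1) r ord0 (lift ord0 i) / (1 - r ord0 (lift ord0 i)).
Proof.
move=> c0 rc; have [[r01 _ _] _] := rc.
have n0 : 0 <= n%:R :> R by rewrite ler0n.
have nE : n.+1%:R = n%:R + 1 :> R by rewrite natr1.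
pose y := (1 - c) / n.+1%:R.
have y1 : y < 1 by rewrite /y nE ltr_pdivrMr; lra.
have := @ler_sum R _ (index_enum 'I_n.+1) predT
  (fun i => y / (1 - y) + (r ord0 (lift ord0 i) - y) / (1 - y) ^+ 2) _
  (fun i _ => odds_tangent _ _ _ (andP (r01 (lift ord0 i))).2 y1).
(* The two sides are equal: since [y] is the mean of the tail, the linear terms cancel, leaving
   [n.+1] copies of [y / (1 - y) = (1 - c) / (n + c)]. *)
apply: le_trans; rewrite le_eqVlt; apply/orP; left; apply/eqP.
rewrite big_split /= sumr_const -mulr_suml sumrB sumr_const card_ord.
rewrite (popularities_at_sum _ _ _ _ rc) -(mulr_natr (y / _)) -(mulr_natr y).
by rewrite /y nE; field; rewrite !gt_eqF//; lra.
Qed.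

Lemma sum_odds_lt (R : realType) (n : nat) (c : R) (r : 'rV[R]_n.+2) :
  (0 < n)%N -> 0 < c -> popularities_at c r ->
  \sum_(i < n.+1) r ord0 (lift ord0 i) / (1 - r ord0 (lift ord0 i)) <
  (1 - c) / c.
Proof.
move=> n0 c0 rc; have [[r01 _ _] _] := rc.
rewrite -(popularities_at_sum _ _ _ _ rc) mulr_suml; apply: ltr_sum.
  by apply/hasP; exists ord0; rewrite ?mem_index_enum.
move=> i _; have /andP[ri0 ri1] := r01 (lift ord0 i).
rewrite ltr_pM2l// ltf_pV2 ?posrE//; last by rewrite subr_gt0.
(* The goal [c < 1 - r_i] becomes [r_i < 1 - c], where [1 - c] is the whole tail sum; a second tail
   entry, present because [0 < n], makes it strict. *)
rewrite ltrBrDl -ltrBrDr -(popularities_at_sum _ _ _ _ rc) (bigD1 i)//= ltrDl.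
have [j ji] : exists j : 'I_n.+1, j != i.
  case: (eqVneq i ord0) => [->|]; last by exists ord0; rewrite eq_sym.
  by exists (inord 1); rewrite -val_eqE /= inordK.
rewrite (bigD1 j)//= ltr_wpDr ?sumr_ge0//.
  by move=> k _; have /andP[/ltW] := r01 (lift ord0 k).
by have /andP[] := r01 (lift ord0 j).
Qed.

(* (c, 1 - c - (K - 2) e, e, ..., e), written as an affine function of e so that
   its continuity is immediate *)
Definition tail_path (R : realType) (K : nat) (c e : R) : 'rV[R]_K :=
  two_name_vector K c +
  e *: \row_(i < K) (if i == 0%N :> nat then 0
                     else if i == 1%N :> nat then 2 - K%:R else 1).

Lemma tail_pathE (R : realType) (K : nat) (c e : R) (i : 'I_K) :
  tail_path R K c e ord0 i =
  if i == 0%N :> nat then c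
  else if i == 1%N :> nat then 1 - c - (K%:R - 2) * e else e.
Proof.
by rewrite !mxE; case: eqP => _; [ring|case: eqP => _; ring].
Qed.

Lemma tail_path_continuous (R : realType) (K : nat) (c : R) :
  continuous (tail_path R K c).
Proof.
move=> e; apply: cvgD; first exact: cvg_cst.
by apply: cvgZ; [exact: cvg_id|exact: cvg_cst].
Qed.

Lemma tail_path0 (R : realType) (K : nat) (c : R) :
  tail_path R K c 0 = two_name_vector K c.
Proof. by rewrite /tail_path scale0r addr0. Qed.

(** This [e] solves [1 - c - (K - 2) e = e], so all tail entries agree. *)
Lemma tail_path_uniform (R : realType) (K : nat) (c : R) : (1 < K)%N ->
  tail_path R K c ((1 - c) / (K%:R - 1)) = uniform_vector K c.
Proof.
move=> K1; have K0 : K%:R - 1 != 0 :> R by rewrite subr_eq0 pnatr_eq1 gtn_eqF.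
apply/rowP => i; rewrite tail_pathE mxE.
by case: eqP => // _; case: eqP => // _; field.
Qed.

(** The upper bound on [e] rearranges to [e <= 1 - c - n e]: the second entry dominates the later
    ones, and is therefore positive. *)
Lemma tail_path_popularities (R : realType) (n : nat) (c e : R) :
  0 < c < 1 -> 0 < e <= (1 - c) / n.+1%:R ->
  popularities_at c (tail_path R n.+2 c e).
Proof.
move=> c01 /andP[e0]; rewrite ler_pdivlMr ?ltr0n// -natr1 => es.
have en : 0 <= n%:R * e by rewrite mulr_ge0// ltW.
have nE : n.+2%:R - 2 = n%:R :> R by rewrite -(natrB _ (isT : 1 < n.+2)%N) subn2.
split; last by move=> i i0; rewrite tail_pathE i0.
split=> [i||i j i0 ij].
- by rewrite tail_pathE nE; case: eqP => // _; case: eqP => _; lra.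
- rewrite 2!big_ord_recl !tail_pathE /= nE.
  under eq_bigr do rewrite tail_pathE /=.
  by rewrite sumr_const card_ord -mulr_natl; ring.
- rewrite !tail_pathE nE (gtn_eqF i0) (gtn_eqF (leq_trans i0 ij)).
  case: (eqVneq (i : nat) 1%N) => i1; case: (eqVneq (j : nat) 1%N) => j1; try lra.
  (* The case [i != 1], [j = 1] contradicts [0 < i <= j]. *)
  lia.
Qed.

(** Zero entries are allowed so that this applies at the limit vector [(c, 1 - c, 0, ..., 0)];
    nonnegativity keeps the outer denominator at least 3. *)
Lemma prob_boy_continuous_at (R : realType) (n : nat) (r : 'rV[R]_n.+1) :
  (forall i : 'I_n, 0 <= r ord0 (lift ord0 i) < 1) ->
  {for r, continuous (@prob_boy R n.+1)}.
Proof.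
move=> r01; rewrite (funext (@prob_boyE R n)) /prop_for /continuous_at.
have FF : Filter (nbhs r) := nbhs_filter r.
apply: cvgM; first exact: cvg_cst.
apply: cvgV.
  rewrite gt_eqF// ltr_wpDr// sumr_ge0// => i _.
  by have /andP[? /ltW ?] := r01 i; rewrite divr_ge0// subr_ge0.
apply: cvgD; first exact: cvg_cst.
apply: cvg_big; [exact: add_continuous|move=> i _].
have /andP[_ ri1] := r01 i.
apply: cvgM; first exact: coord_continuous.
apply: cvgV; first by rewrite subr_eq0 gt_eqF.
by apply: cvgB; [exact: cvg_cst|exact: coord_continuous].
Qed.

Lemma prob_boy_two_name (R : realType) (n : nat) (c : R) : 0 < c < 1 ->
  prob_boy (two_name_vector n.+2 c) = 2 * c / (2 * c + 1).
Proof.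
move=> c01; rewrite prob_boyE big_ord_recl big1 => [|i _]; rewrite !mxE /=.
  by field; rewrite !gt_eqF//; lra.
by rewrite mul0r.
Qed.

Lemma prob_boy_uniform (R : realType) (n : nat) (c : R) : 0 < c < 1 ->
  prob_boy (uniform_vector n.+2 c) =
  2 * (n%:R + c) / (4 * (n%:R + c) + 1 - (n%:R + 2) * c).
Proof.
move=> c01; have n0 : 0 <= n%:R :> R by rewrite ler0n.
(* This nonlinear fact lets [lra] see that [4 (n + c) + 1 - (n + 2) c] is positive. *)
have nc : n%:R * c <= n%:R :> R by rewrite ler_piMr//; lra.
rewrite prob_boyE; under eq_bigr do rewrite !mxE /=.
rewrite sumr_const card_ord -mulr_natl.
have -> : n.+2%:R - 1 = n.+1%:R :> R by rewrite -natr1 addrK.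
by rewrite -natr1; field; rewrite !gt_eqF//; lra.
Qed.

Lemma prob_boy_gt (R : realType) (n : nat) (c : R) (r : 'rV[R]_n.+2) :
  (0 < n)%N -> 0 < c < 1 -> popularities_at c r ->
  2 * c / (2 * c + 1) < prob_boy r.
Proof.
move=> n_gt0 c01 rc; have [c0 _] := andP c01.
have n0 : 0 <= n%:R :> R by rewrite ler0n.
(* In this form only the sums of odds remain to be compared. *)
have -> : 2 * c / (2 * c + 1) = 2 / (3 + (1 - c) / c).
  by field; rewrite !gt_eqF//; lra.
rewrite prob_boyE ltr_pM2l// ltf_pV2 ?posrE.
- by rewrite ltrD2l sum_odds_lt.
- by rewrite ltr_wpDr// divr_ge0//; lra.
rewrite ltr_wpDr// (le_trans _ (sum_odds_ge _ _ _ _ c0 rc))//.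
by rewrite divr_ge0 ?mulr_ge0 ?ler0n//; lra.
Qed.

Lemma prob_boy_le_uniform (R : realType) (n : nat) (c : R) (r : 'rV[R]_n.+2) :
  0 < c < 1 -> popularities_at c r ->
  prob_boy r <= prob_boy (uniform_vector n.+2 c).
Proof.
move=> c01 rc; have [c0 _] := andP c01.
have n0 : 0 <= n%:R :> R by rewrite ler0n.
have nc : n%:R * c <= n%:R :> R by rewrite ler_piMr//; lra.
have -> : prob_boy (uniform_vector n.+2 c) =
    2 / (3 + n.+1%:R * (1 - c) / (n%:R + c)).
  by rewrite prob_boy_uniform// -natr1; field; rewrite !gt_eqF//; lra.
have odds_ge0 : 0 <= n.+1%:R * (1 - c) / (n%:R + c).
  by rewrite divr_ge0 ?mulr_ge0 ?ler0n//; lra.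
rewrite prob_boyE ler_pM2l// lef_pV2 ?posrE ?ltr_wpDr//.
  by rewrite lerD2l sum_odds_ge.
exact: le_trans (sum_odds_ge _ _ _ _ c0 rc).
Qed.

Theorem theorem3 (R : realType) (K : nat) (hK : (2 <= K)%N)
    (r1 : R) (hr1 : 0 < r1 < 1) :
  (K = 2%N ->
     @prob_boy R K @` @popularities_at R K r1 =
       [set 2 * r1 / (2 * r1 + 1)]) /\
  ((2 < K)%N ->
     [/\ @prob_boy R K @` @popularities_at R K r1 =
           `] 2 * r1 / (2 * r1 + 1),
              2 * (K%:R - 2 + r1) / (4 * (K%:R - 2 + r1) + 1 - K%:R * r1)
            ]%classic,
         closure (@popularities_at R K r1) (two_name_vector K r1),
         @prob_boy R K r
           @[r --> within (@popularities_at R K r1)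
                          (nbhs (two_name_vector K r1))]
           --> 2 * r1 / (2 * r1 + 1),
         popularities_at r1 (uniform_vector K r1)
       & prob_boy (uniform_vector K r1) =
           2 * (K%:R - 2 + r1) / (4 * (K%:R - 2 + r1) + 1 - K%:R * r1)]).
Proof.
case: K hK => [|[|n]]// _.
have nE : n.+2%:R - 2 = n%:R :> R by rewrite -(natrB _ (isT : 1 < n.+2)%N) subn2.
have n2E : n.+2%:R = n%:R + 2 :> R by rewrite -nE subrK.
have n0 : 0 <= n%:R :> R by rewrite ler0n.
have s0 : 0 < (1 - r1) / n.+1%:R by rewrite divr_gt0 ?ltr0n//; lra.
have path_unif : tail_path R n.+2 r1 ((1 - r1) / n.+1%:R) = uniform_vector n.+2 r1.
  by rewrite -tail_path_uniform// -[n.+2%:R]natr1 addrK.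
have pop_unif : popularities_at r1 (uniform_vector n.+2 r1).
  rewrite -path_unif.
  by apply: tail_path_popularities; rewrite // s0 lexx.
have boy_unif : prob_boy (uniform_vector n.+2 r1) = 2 * (n.+2%:R - 2 + r1) /
    (4 * (n.+2%:R - 2 + r1) + 1 - n.+2%:R * r1).
  by rewrite prob_boy_uniform// nE n2E.
split=> [[n_eq0]|]; last rewrite 2!ltnS => n_gt0.
  (* With two names the tail is the single entry [1 - r1], so the probability is constant. *)
  have boy_const (r : 'rV[R]_n.+2) : popularities_at r1 r ->
      prob_boy r = 2 * r1 / (2 * r1 + 1).
    subst n => rc; have := popularities_at_sum _ _ _ _ rc.
    rewrite prob_boyE !big_ord1 => ->.
    by field; rewrite !gt_eqF//; lra.
  apply/seteqP; split=> [_ [r rc <-]|_ ->]; first exact: boy_const.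
  by exists (uniform_vector n.+2 r1) => //; exact: boy_const.
(* The endpoint [e = 0] is included although the path is not in the popularity set there: the
   intermediate value theorem needs a closed interval. *)
have boy_path_continuous e : 0 <= e <= (1 - r1) / n.+1%:R ->
    {for e, continuous (@prob_boy R n.+2 \o tail_path R n.+2 r1)}.
  move=> /andP[e0]; rewrite ler_pdivlMr ?ltr0n// -natr1 => es.
  have en : 0 <= n%:R * e by rewrite mulr_ge0.
  apply: continuous_comp; first exact: tail_path_continuous.
  apply: prob_boy_continuous_at => i.
  by rewrite tail_pathE nE /=; case: eqP => _; lra.
split=> //.
- apply/seteqP; split=> [_ [r rc <-]|p].
    by rewrite /= in_itv /= -boy_unif prob_boy_gt// prob_boy_le_uniform.
  rewrite /= in_itv /= => /andP[p_gt p_le].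
  have [||e] := @IVT R (@prob_boy R n.+2 \o tail_path R n.+2 r1)
    0 ((1 - r1) / n.+1%:R) p (ltW s0).
  + apply: continuous_in_subspaceT => e; rewrite inE /= in_itv /=.
    exact: boy_path_continuous.
  + rewrite /= tail_path0 prob_boy_two_name// ge_min (ltW p_gt) /=.
    by rewrite le_max path_unif boy_unif p_le orbT.
  rewrite in_itv /= => /andP[e0 es] pe.
  exists (tail_path R n.+2 r1 e) => //.
  apply: tail_path_popularities; rewrite // es andbT lt_neqAle e0 andbT.
  (* At [e = 0] the value would be the excluded lower endpoint. *)
  apply/eqP => e_eq0; move: p_gt.
  by rewrite -pe -e_eq0 /= tail_path0 prob_boy_two_name// ltxx.
(* The path as [e] tends to 0 from the right meets every neighbourhood of the limit vector, so the
   limit proved next is not vacuous. *)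
- move=> B B0.
  have nearB : \forall e \near 0^'+, B (tail_path R n.+2 r1 e).
    apply: cvg_within; apply: tail_path_continuous.
    by rewrite tail_path0.
  have near_pop : \forall e \near 0^'+,
      popularities_at r1 (tail_path R n.+2 r1 e).
    near=> e; apply: tail_path_popularities => //; apply/andP; split=> //.
    by near: e; exact: nbhs_right_le.
  have [e [popE BE]] :=
    @filter_ex _ _ (at_right_proper_filter 0) _ (filterI near_pop nearB).
  by exists (tail_path R n.+2 r1 e).
(* The claimed limit is the value at the limit vector, where [prob_boy] is continuous in the whole
   space. *)
- apply: cvg_within_filter; rewrite -(prob_boy_two_name _ n)//.
  apply: prob_boy_continuous_at => i.
  by rewrite !mxE /=; case: eqP => _; lra.
Unshelve. all: by end_near.
Qed.
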